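(* Let $V$ be a real locally convex topological vector space, $H$ a real Hilbert space, $j:V\to H$ a linear, weak-to-weak continuous operator, and let $\varphi: V\to\mathbb{R}\cup\{+\infty\}$ be convex, proper, lower semicontinuous and $j$-elliptic. Let $\varphi^H:H\to\mathbb{R}\cup\{+\infty\}$ be a convex, proper, lower semicontinuous functional such that $\partial_j\varphi\subseteq\partial\varphi^H$. Fix $(u_0,f_0)\in\partial_j\varphi$, and for $u\in H$ define $$\varphi_0(u)=\inf_{j(\hat u)=u}\varphi(\hat u),\qquad \varphi_1(u)=\sup_{\substack{U\subseteq H\text{ open}\\ u\in U}}\ \inf_{j(\hat v)\in U}\varphi(\hat v),$$ $$\varphi_2(u)=\sup\Big\{\sum_{i=0}^n\langle f_i,u_{i+1}-u_i\rangle_H+\varphi_0(u_0)\;:\; n\in\mathbb{N},\ (u_i,f_i)\in\partial_j\varphi\text{ for }i=1,\dots,n,\ u_{n+1}=u\Big\},$$ $$\varphi_3(u)=\sup\big\{\langle f,u-v\rangle_H+\varphi_0(v)\;:\;(v,f)\in\partial_j\varphi\big\}.$$ Then $$\varphi^H=\varphi_0=\varphi_1=\varphi_2=\varphi_3,$$ where the first equality holds modulo an additive constant (and the others hold exactly), and $$D(\varphi^H)=j(D(\varphi)).$$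
   Context: The infimum over the empty set is $+\infty$. The effective domain of a functional $\psi$ is $D(\psi)=\{\psi<+\infty\}$; $\psi$ is proper if $D(\psi)\neq\emptyset$, and lower semicontinuous if all sublevels $\{\psi\le c\}$, $c\in\mathbb{R}$, are closed. A functional on $V$ is coercive if all its sublevels are relatively weakly compact. With $\varphi_{(\omega)}(\hat u):=\varphi(\hat u)+\frac{\omega}{2}\|j(\hat u)\|_H^2$, the functional $\varphi$ is $j$-elliptic if there exists $\omega\ge 0$ such that $\varphi_{(\omega)}$ is convex and coercive. The $j$-subgradient of $\varphi$ is the relation $$\partial_j\varphi=\Big\{(u,f)\in H\times H \;:\; \exists\,\hat u\in D(\varphi)\text{ with } j(\hat u)=u \text{ and, for every }\hat v\in V,\ \liminf_{t\searrow 0}\frac{\varphi(\hat u+t\hat v)-\varphi(\hat u)}{t}\ge\langle f,j(\hat v)\rangle_H\Big\}.$$ For a functional $\psi$ on $H$, $\partial\psi$ denotes the classical subgradient, i.e. the $j$-subgradient for $V=H$ and $j=I$. *)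

(* Defs.v *)
From HB Require Import structures.
From mathcomp Require Import all_boot all_order all_algebra.
From mathcomp Require Import all_classical all_reals all_analysis.

Set Implicit Arguments.
Unset Strict Implicit.
Unset Printing Implicit Defensive.

Import Order.TTheory GRing.Theory Num.Theory.
Import numFieldNormedType.Exports.

Local Open Scope classical_set_scope.
Local Open Scope ring_scope.

(* The topological dual: linear forms continuous for the original topology. *)
Definition continuous_dual (R : realType) (E : tvsType R) : Type :=
  {f : {linear E -> R^o} | continuous f}.

(* The coarsest topology on E for which every element of the dual is
   continuous; its carrier is E itself. *)
Definition weak_topology (R : realType) (E : tvsType R) : topologicalType :=
  @sup_topology E (continuous_dual E)
    (fun f => Topological.class (initial_topology (sval f : E -> R^o))).

Definition weak_weak_continuous (R : realType) (E F : tvsType R) (j : E -> F) :=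
  continuous (j : weak_topology E -> weak_topology F).

(* Functionals with values in R \cup {+oo} are maps to \bar R that avoid -oo. *)
Definition no_ninfty (R : realType) (E : Type) (psi : E -> \bar R) :=
  forall v, psi v <> -oo%E.

Definition effective_domain (R : realType) (E : Type) (psi : E -> \bar R) :
  set E := [set v | (psi v < +oo)%E].

Definition sublevel (R : realType) (E : Type) (psi : E -> \bar R) (c : R) :
  set E := [set v | (psi v <= c%:E)%E].

Definition proper_functional (R : realType) (E : Type) (psi : E -> \bar R) :=
  effective_domain psi !=set0.

(* At t = 0 or t = 1 the convention 0 * +oo = 0 makes the inequality trivial. *)
Definition convex_functional (R : realType) (E : lmodType R) (psi : E -> \bar R) :=
  forall (x y : E) (t : R), 0 <= t <= 1 ->
    (psi (t *: x + (1 - t) *: y)%R <= t%:E * psi x + (1 - t)%R%:E * psi y)%E.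

(* The library notion coincides with closedness of all real sublevels. *)
Lemma lower_semicontinuous_sublevel (R : realType) (E : topologicalType)
    (psi : E -> \bar R) :
  lower_semicontinuous psi <-> forall c : R, closed (sublevel psi c).
Proof.
rewrite lower_semicontinuousP; split=> H c.
- suff -> : sublevel psi c = ~` [set x | (c%:E < psi x)%E] by exact: open_closedC.
  by apply/seteqP; split=> x /=; rewrite /sublevel/= leNgt => /negP.
- suff -> : [set x | (c%:E < psi x)%E] = ~` sublevel psi c by exact: closed_openC.
  by apply/seteqP; split=> x /=; rewrite /sublevel/= ltNge => /negP.
Qed.

Definition weakly_coercive (R : realType) (E : tvsType R) (psi : E -> \bar R) :=
  forall c : R, precompact (sublevel psi c : set (weak_topology E)).

Definition phi_omega (R : realType) (V : Type) (H : normedModType R)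
    (j : V -> H) (phi : V -> \bar R) (omega : R) : V -> \bar R :=
  fun v => (phi v + (omega / 2 * `|j v| ^+ 2)%R%:E)%E.

Definition j_elliptic (R : realType) (V : tvsType R) (H : normedModType R)
    (j : V -> H) (phi : V -> \bar R) :=
  exists omega : R, [/\ 0 <= omega, convex_functional (phi_omega j phi omega)
                      & weakly_coercive (phi_omega j phi omega)].

(* A real Hilbert space is a complete normed module whose norm is the one
   induced by a positive definite symmetric bilinear form ip. *)
Definition norm_from (R : realType) (H : normedModType R)
    (ip : {dot H for @idfun R}) :=
  forall u : H, `|u| ^+ 2 = ip u u.

Definition j_subgradient (R : realType) (H : normedModType R)
    (ip : {dot H for @idfun R}) (V : lmodType R)
    (j : V -> H) (phi : V -> \bar R) : set (H * H) :=
  [set uf | exists uh : V, [/\ effective_domain phi uh, j uh = uf.1 &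
    forall vh : V,
      ((ip uf.2 (j vh))%:E <=
       limf_einf (fun t : R => (phi (uh + t *: vh)%R - phi uh) * (t^-1)%R%:E)
                 0^'+%R)%E]].

Definition subgradient (R : realType) (H : normedModType R)
    (ip : {dot H for @idfun R}) (psi : H -> \bar R) : set (H * H) :=
  j_subgradient ip (@idfun H) psi.

Definition phi0 (R : realType) (V : Type) (H : normedModType R)
    (j : V -> H) (phi : V -> \bar R) (u : H) : \bar R :=
  ereal_inf (phi @` [set uh | j uh = u]).

Definition phi1 (R : realType) (V : Type) (H : normedModType R)
    (j : V -> H) (phi : V -> \bar R) (u : H) : \bar R :=
  ereal_sup [set ereal_inf (phi @` [set vh | U (j vh)])
            | U in [set U : set H | open U /\ U u]].

Definition phi2 (R : realType) (H : normedModType R)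
    (ip : {dot H for @idfun R}) (V : lmodType R)
    (j : V -> H) (phi : V -> \bar R) (u0 f0 : H) (u : H) : \bar R :=
  ereal_sup [set x | exists (n : nat) (u_ f_ : nat -> H),
    [/\ u_ 0%N = u0 /\ f_ 0%N = f0,
        forall i, (1 <= i <= n)%N -> j_subgradient ip j phi (u_ i, f_ i),
        u_ n.+1 = u
      & x = ((\sum_(0 <= i < n.+1) ip (f_ i) (u_ i.+1 - u_ i))%R%:E
             + phi0 j phi u0)%E]].

Definition phi3 (R : realType) (H : normedModType R)
    (ip : {dot H for @idfun R}) (V : lmodType R)
    (j : V -> H) (phi : V -> \bar R) (u : H) : \bar R :=
  ereal_sup [set ((ip vf.2 (u - vf.1))%R%:E + phi0 j phi vf.1)%E
            | vf in j_subgradient ip j phi].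

(* Main.v *)
From HB Require Import structures.
Require Import Defs.
From mathcomp Require Import all_boot all_order all_algebra.
From mathcomp Require Import all_classical all_reals all_analysis.
From mathcomp Require Import ring lra.

Set Implicit Arguments.
Unset Strict Implicit.
Unset Printing Implicit Defensive.

Import Order.TTheory GRing.Theory Num.Theory.
Import numFieldNormedType.Exports.

Local Open Scope classical_set_scope.
Local Open Scope ring_scope.

(** Let [A] be the [j]-subgradient of [phi]. By convexity, [(u, f)] belongs to
[A] exactly when some [uh] over [u] satisfies [phi v >= phi uh + <f, j v - u>]
for all [v]; then [phi uh = phi0 u], and [phi0] has an affine minorant touching
it at [u] ([subgradient_global], [phi0_subgradient]).

Everything rests on the penalized functionals [phi v + K |j v - u|^2] with
[K >= 1/2]. Their sublevels are closed and convex, hence weakly closed by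
Mazur's theorem ([convex_weakly_closed]); a minorant as above bounds the penalty
on them, so that they lie in a sublevel of [phi + omega/2 |j|^2], which is
weakly precompact by ellipticity. A directed family of nonempty such sublevels
therefore has a common point ([penalized_bigcap]). This is used twice.
- Each penalized functional has a minimizer [uh], and its first variation says
  that [(j uh, 2K (u - j uh))] is in [A] ([resolvent]); with [K = 1/2] this makes
  [I + A] surjective.
- Inserting these pairs into the supremum [phi3 u = c] yields, for every [K], a
  point with penalized value at most [c]. A point common to all these sublevels
  lies over [u], whence [phi0 u <= c] ([phi0_le_phi3]).
Since [phi3 <= phi1 <= phi0] is elementary, [phi0], [phi1] and [phi3] agree.

For [phi2] and [phiH], join two pairs [(u, f)], [(v, g)] of [A] by pairs
[(x_i, h_i)] of [A] whose sums [x_i + h_i] divide the segment from [u + f] to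
[v + g] into [N] equal parts. As [2 <dh, dx> <= |dx + dh|^2 = O(N^-2)], the sums
[\sum <h_i, x_{i+1} - x_i>] recover the increment [phi0 v - phi0 u] up to
[O(1/N)] ([potential_chain]). Appending a last affine step gives
[phi3 <= phi2], the converse being a telescoping sum. The increments of [phiH]
dominate the same sums, so that [phiH - phi0] is a constant [c] on the domain of
[A] ([potential_unique]). Taking the supremum of affine minorants extends
[phiH >= phi0 + c] to all of [H]; the reverse inequality follows from the lower
semicontinuity of [phiH], because [j uh] tends to [u] as [K] tends to infinity
while [phi uh] stays below every value of [phi] over [u]. *)

(** * Hahn-Banach theorem and separation *)

Section HahnBanach.
Variables (R : realType) (V : lmodType R).

Definition sublinear (p : V -> R) :=
  (forall x y, p (x + y) <= p x + p y) /\
  (forall r x, 0 < r -> p (r *: x) <= r * p x).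

Lemma sublinearZ p r x : sublinear p -> 0 < r -> p (r *: x) = r * p x.
Proof.
move=> [_ pZ] r0; apply/eqP; rewrite eq_le pZ//=.
have := pZ r^-1 (r *: x); rewrite invr_gt0 => /(_ r0).
by rewrite scalerA mulVf ?gt_eqF// scale1r ler_pdivlMl.
Qed.

Lemma sublinear0 p : sublinear p -> p 0 = 0.
Proof.
move=> sp; have := @sublinearZ p 2 0 sp ltac:(lra).
by rewrite scaler0; lra.
Qed.

Lemma sublinear_opp p x : sublinear p -> - p (- x) <= p x.
Proof.
move=> sp; have := sp.1 x (- x); rewrite subrr (sublinear0 sp); lra.
Qed.

(** The largest sublinear functional below [q] whose value at [- x] is at most
[- q x]. *)
Definition tilt (q : V -> R) x y :=
  inf [set q (y + t *: x) - t * q x | t in [set t | 0 <= t]].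

Lemma has_inf_tilt q x y : sublinear q ->
  has_inf [set q (y + t *: x) - t * q x | t in [set t | 0 <= t]].
Proof.
move=> sq; split.
  by exists (q (y + 0 *: x) - 0 * q x), 0 => //=.
exists (- q (- y)) => _ [t /= t0 <-].
have : q (t *: x) <= q (y + t *: x) + q (- y).
  by rewrite (le_trans _ (sq.1 _ _))// addrC addKr.
have [->|tn0] := eqVneq t 0; first by rewrite !scale0r addr0 (sublinear0 sq); lra.
by rewrite sublinearZ ?lt_neqAle 1?eq_sym ?tn0//; lra.
Qed.

Lemma tilt_le q x y t : sublinear q -> 0 <= t ->
  tilt q x y <= q (y + t *: x) - t * q x.
Proof.
by move=> sq t0; apply: ge_inf; [exact: (has_inf_tilt x y sq).2|exists t].
Qed.

Lemma sublinear_tilt q x : sublinear q -> sublinear (tilt q x).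
Proof.
move=> sq; split=> [y z|r y r0].
  apply/ler_addgt0Pr => e e0.
  have e20 : 0 < e / 2 by lra.
  have [_ [s /= s0 <-] hs] := inf_adherent e20 (has_inf_tilt x y sq).
  have [_ [t /= t0 <-] ht] := inf_adherent e20 (has_inf_tilt x z sq).
  have := tilt_le x (y + z) sq (addr_ge0 s0 t0).
  have := sq.1 (y + s *: x) (z + t *: x).
  rewrite addrACA -scalerDl.
  by rewrite -/(tilt q x y) in hs; rewrite -/(tilt q x z) in ht; lra.
rewrite -ler_pdivrMl//.
apply: lb_le_inf; first exact: (has_inf_tilt x y sq).1.
move=> _ [t /= t0 <-]; rewrite ler_pdivrMl//.
have := @tilt_le q x (r *: y) (r * t) sq (mulr_ge0 (ltW r0) t0).
rewrite -scalerA -scalerDr (sublinearZ _ sq r0); lra.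
Qed.

(** By Zorn's lemma there is a minimal sublinear functional below [p]. It
coincides with all its tilts, which makes it superadditive, hence linear. *)
Lemma hahn_banach_sublinear (p : V -> R) : sublinear p ->
  exists f : {linear V -> R^o}, forall x, f x <= p x.
Proof.
move=> sp.
pose T := {q : V -> R | sublinear q /\ forall x, q x <= p x}.
pose le (q q' : T) : bool := `[< forall x, sval q' x <= sval q x >].
have [|q1 q2 q3 /asboolP h1 /asboolP h2|[q1 P1] [q2 P2]|F Ftot|[q [sq qp]] qmin] :=
    @Zorn T le.
- by move=> q; apply/asboolP.
- by apply/asboolP => x; exact: le_trans (h2 x) (h1 x).
- move=> /asboolP/= h1 /asboolP/= h2; apply: eq_exist; apply/funext => x.
  by apply/eqP; rewrite eq_le h1 h2.
- have [->|/set0P[q0 Fq0]] := eqVneq F set0.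
    by exists (exist _ p (conj sp (fun x => lexx (p x)))) => s.
  pose S x := [set sval q x | q in F].
  have hS x : has_inf (S x).
    split; first by exists (sval q0 x), q0.
    exists (- p (- x)) => _ [[q [sq qp]] Fq <-] /=.
    by apply: le_trans (sublinear_opp x sq); rewrite lerN2.
  have Sle x q : F q -> inf (S x) <= sval q x.
    by move=> Fq; apply: ge_inf; [exact: (hS x).2|exists q].
  have sinf : sublinear (fun x => inf (S x)).
    split=> [x y|r x r0].
      apply/ler_addgt0Pr => e e0.
      have e20 : 0 < e / 2 by lra.
      have [_ [a Fa <-] ha] := inf_adherent e20 (hS x).
      have [_ [b Fb <-] hb] := inf_adherent e20 (hS y).
      have [/asboolP ab|/asboolP ba] := Ftot _ _ Fa Fb.
        have := (svalP b).1.1 x y; have := Sle (x + y) _ Fb; have := ab x; lra.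
      have := (svalP a).1.1 x y; have := Sle (x + y) _ Fa; have := ba y; lra.
    rewrite -ler_pdivrMl//; apply: lb_le_inf; first exact: (hS x).1.
    move=> _ [a Fa <-]; rewrite ler_pdivrMl//.
    by apply: le_trans (Sle _ _ Fa) _; exact: (svalP a).1.2.
  have infp x : inf (S x) <= p x.
    by apply: le_trans (Sle x _ Fq0) _; exact: (svalP q0).2.
  exists (exist _ (fun x => inf (S x)) (conj sinf infp)) => q Fq.
  by apply/asboolP => x /=; exact: Sle.
- have tiltE x : tilt q x = q.
    have tq y : tilt q x y <= q y.
      have := @tilt_le q x y 0 sq (lexx _).
      by rewrite scale0r addr0 mul0r subr0.
    have tp y : tilt q x y <= p y := le_trans (tq y) (qp y).
    have := qmin (exist _ (tilt q x) (conj (sublinear_tilt x sq) tp)).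
    by move=> /(_ (asboolT tq)) [].
  have qD x y : q (x + y) = q x + q y.
    apply/eqP; rewrite eq_le sq.1/=.
    have := @tilt_le q y x 1 sq ler01.
    by rewrite tiltE scale1r mul1r; lra.
  have qN x : q (- x) = - q x.
    by have := qD x (- x); rewrite subrr (sublinear0 sq); lra.
  have qlin : linear (q : V -> R^o).
    move=> a x y; rewrite qD; congr (_ + _).
    change (q (a *: x) = a * q x).
    have [a0|a0|->] := ltrgtP a 0; last by rewrite scale0r (sublinear0 sq) mul0r.
      rewrite -[a]opprK scaleNr qN (sublinearZ _ sq) ?oppr_gt0//.
      by rewrite !mulNr.
    exact: sublinearZ.
  pose fl := GRing.isLinear.Build R V R^o *:%R q qlin.
  pose f : {linear V -> R^o} := HB.pack (q : V -> R^o) fl.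
  by exists f.
Qed.

End HahnBanach.

Section Separation.
Variables (R : realType) (V : lmodType R).

Lemma convex_setP (C : set V) : convex_set C <-> forall x y (t : R),
  C x -> C y -> 0 <= t <= 1 -> C (t *: x + (1 - t) *: y).
Proof.
split=> [cC x y t Cx Cy /andP[t0 t1]|cC x y t /set_mem Cx /set_mem Cy].
  have := cC x y (Itv01 t0 t1) (mem_set Cx) (mem_set Cy).
  by move=> /set_mem.
by apply/mem_set; apply: cC => //; rewrite ge0 le1.
Qed.

Lemma convex_set_combine (C : set V) (s t : R) x y : convex_set C ->
  0 <= s -> 0 <= t -> C x -> C y ->
  exists2 z, C z & s *: x + t *: y = (s + t) *: z.
Proof.
move=> cC s0 t0 Cx Cy; have [st0|st0] := eqVneq (s + t) 0.
  exists x => //; have -> : s = 0 by lra.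
  have -> : t = 0 by lra.
  by rewrite addr0 !scale0r addr0.
have stp : 0 < s + t by rewrite lt_neqAle eq_sym st0 addr_ge0.
exists ((s / (s + t)) *: x + (1 - s / (s + t)) *: y).
  apply: (convex_setP C).1 => //; rewrite divr_ge0 ?(ltW stp)//= ler_pdivrMr//; lra.
rewrite scalerDr !scalerA; congr (_ *: _ + _ *: _); by field.
Qed.

(** The sublinear functional [y |-> inf {s - t | y = s u - t c}] is at most
[1] on [U] and at most [-1] on [- C]. It does not take the value [-oo] because
[0 = s u - t c] with [s < t] would put [c] in [U]. *)
Lemma separate_convex_sets (U C : set V) :
  convex_set U -> convex_set C -> U 0 -> C !=set0 -> U `&` C = set0 ->
  (forall y, exists2 s : R, 0 < s & U (s^-1 *: y)) ->
  exists f : {linear V -> R^o},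
    (forall u, U u -> f u <= 1) /\ (forall c, C c -> 1 <= f c).
Proof.
move=> cU cC U0 [c0 Cc0] UC0 Uabs.
pose S y := [set r : R | exists s t u c, [/\ 0 <= s, 0 <= t, U u, C c &
   y = s *: u - t *: c /\ r = s - t]].
have SD x y a b : S x a -> S y b -> S (x + y) (a + b).
  move=> [s [t [u [c [s0 t0 Uu Cc [-> ->]]]]]].
  move=> [s' [t' [u' [c' [s0' t0' Uu' Cc' [-> ->]]]]]].
  have [u2 Uu2 u2E] := convex_set_combine cU s0 s0' Uu Uu'.
  have [c2 Cc2 c2E] := convex_set_combine cC t0 t0' Cc Cc'.
  exists (s + s'), (t + t'), u2, c2; split => //; try lra.
  by rewrite -u2E -c2E opprD addrACA; split=> //; lra.
have S0 a : S 0 a -> 0 <= a.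
  move=> [s [t [u [c [s0 t0 Uu Cc [/eqP + ->]]]]]].
  rewrite eq_sym subr_eq0 => /eqP E; rewrite leNgt; apply/negP => st.
  have tp : 0 < t by lra.
  suff : (U `&` C) c by rewrite UC0.
  split => //; have -> : c = (s / t) *: u + (1 - s / t) *: 0.
    by rewrite scaler0 addr0 mulrC -scalerA E scalerA mulVf ?gt_eqF// scale1r.
  apply: (convex_setP U).1 => //; rewrite divr_ge0//= ler_pdivrMr//; lra.
have Sne y : S y !=set0.
  have [s s0 Us] := Uabs y.
  exists (s - 0), s, 0, (s^-1 *: y), c0; split => //; first exact: ltW.
  by rewrite scalerA divff ?gt_eqF// scale1r scale0r subr0.
have hS y : has_inf (S y).
  split => //; have [b Sb] := Sne (- y); exists (- b) => a Sa.
  have := SD _ _ _ _ Sa Sb; rewrite subrr => /S0; lra.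
have Sle y a : S y a -> inf (S y) <= a.
  by move=> Sa; apply: ge_inf => //; exact: (hS y).2.
have [|f fp] := @hahn_banach_sublinear R V (fun y => inf (S y)).
  split=> [x y|r x r0].
    apply/ler_addgt0Pr => e e0.
    have e20 : 0 < e / 2 by lra.
    have [a Sa ha] := inf_adherent e20 (hS x).
    have [b Sb hb] := inf_adherent e20 (hS y).
    have := Sle _ _ (SD _ _ _ _ Sa Sb); lra.
  rewrite -ler_pdivrMl//; apply: lb_le_inf => // a Sa.
  rewrite ler_pdivrMl//; apply: Sle.
  case: Sa => [s [t [u [c [s0 t0 Uu Cc [-> ->]]]]]].
  exists (r * s), (r * t), u, c; split; rewrite ?mulr_ge0 ?(ltW r0)//.
  by rewrite scalerBr !scalerA; split=> //; lra.
exists f; split=> [u Uu|c Cc].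
  apply: le_trans (fp u) _; apply: Sle.
  exists 1, 0, u, c0; split=> //.
  by rewrite scale1r scale0r !subr0.
have := fp (- c); rewrite linearN/=.
suff : inf (S (- c)) <= - 1 by lra.
apply: Sle; exists 0, 1, 0, c; split=> //.
by rewrite scale1r scale0r !sub0r.
Qed.

End Separation.

(** * Weakly closed convex sets and weak compactness *)

Section WeakTopology.
Variables (R : realType) (V : tvsType R).

Lemma cvg_addr_scale T (F : set_system T) (FF : Filter F) (f : T -> R^o)
    (g : T -> V) (w v : V) (r : R^o) :
  f @ F --> r -> g @ F --> v -> (fun t => w + f t *: g t) @ F --> w + r *: v.
Proof.
move=> fr gv.
have fg : (fun t => f t *: g t) @ F --> r *: v.
  exact: (cvg_comp _ _ (cvg_pair fr gv) (@scale_continuous R V (r, v))).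
exact: (cvg_comp _ _ (cvg_pair (cvg_cst w) fg)
  (@add_continuous V (w, r *: v))).
Qed.

Lemma continuous_weak (f : {linear V -> R^o}) :
  continuous (f : V -> R^o) -> continuous (f : weak_topology V -> R^o).
Proof.
move=> cf x; pose g : continuous_dual V := exist _ f cf.
have : nbhs (x : weak_topology V) --> (x : initial_topology (sval g : V -> R^o)).
  have /cvg_sup : nbhs (x : weak_topology V) --> (x : weak_topology V) by [].
  exact.
by move=> h A /(@initial_continuous V R^o f x); exact: h.
Qed.

Lemma continuous_to_weak : continuous (id : V -> weak_topology V).
Proof.
move=> x; apply/cvg_sup => g A /=.
rewrite (@nbhsE (initial_topology (sval g : V -> R^o))) => -[B [[C oC <-] Bx] BA].
apply: filterS BA _.
have nC : nbhs (sval g x : R^o) C by apply: open_nbhs_nbhs.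
exact: (svalP g x C nC).
Qed.

(** Mazur's theorem. A convex neighbourhood of a point [x] outside [C] that
misses [C] is separated from [C] by a linear form; being bounded above on that
neighbourhood, the form is continuous, and it cuts out a weak neighbourhood of
[x] that misses [C]. *)
Lemma convex_weakly_closed (C : set V) :
  closed C -> convex_set C -> closed (C : set (weak_topology V)).
Proof.
move=> clC cC.
have [->|/set0P[c0 Cc0]] := eqVneq C set0; first exact: closed0.
suff H (x : V) : ~ C x -> nbhs (x : weak_topology V) (~` C).
  by rewrite -[X in closed X]setCK; apply: open_closedC; rewrite openE => x /H.
move=> nCx; have [B Bconv [Bop Bnbhs]] := @locally_convex R V.
have nbx : nbhs x (~` C)   by apply: open_nbhs_nbhs; split; [exact: closed_openC|].
have [b [Bb bx] bC] := Bnbhs x _ nbx.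
have nb : nbhs x b by apply: open_nbhs_nbhs; split; [apply: Bop|].
have cb : convex_set b by apply: Bconv; exact: mem_set.
have trC (D : set V) : convex_set D -> convex_set (fun v => D (x + v)).
  move=> /convex_setP cD; apply/convex_setP => y z t Dy Dz t01.
  have := cD _ _ t Dy Dz t01; congr D.
  rewrite !scalerDr addrACA -scalerDl; congr (_ + _).
  by rewrite addrC subrK scale1r.
(* Both sets are translated so that x becomes the origin. *)
have [| | | | | |f [fU fC]] := @separate_convex_sets R V (fun v => b (x + v)) (fun v => C (x + v)).
- exact: trC.
- exact: trC.
- by rewrite addr0.
- by exists (c0 - x); rewrite addrC subrK.
- by apply/seteqP; split=> // v [/bC].
- move=> y; have : \forall r \near (0 : R)^'+, b (x + r *: y).
    have h : (fun r : R => x + r *: y) @ 0^'+ --> x + (0 : R) *: y.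
      apply: cvg_addr_scale; last exact: cvg_cst.
      exact: cvg_at_right_filter cvg_id.
    by apply: (h b); rewrite scale0r addr0.
  move=> h; near (0 : R)^'+ => r; exists r^-1; first by rewrite invr_gt0.
  by rewrite invrK; near: r.
have cf : continuous (f : V -> R^o).
  move=> y; apply/cvgrPdist_le => e e0.
  have near_b (s : R) : \forall z \near y, b ((x - s *: y) + s *: z).
    have h : (fun z => (x - s *: y) + s *: z) @ y --> (x - s *: y) + s *: y.
      by apply: cvg_addr_scale; [exact: cvg_cst|exact: cvg_id].
    by apply: (h b); rewrite subrK.
  near=> z.
  have h s : b ((x - s *: y) + s *: z) -> s * (f z - f y) <= 1.
    have -> : s * (f z - f y) = f (s *: (z - y)) by rewrite linearZ linearB.
    by move=> bs; apply: fU; rewrite scalerBr addrA addrAC.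
  rewrite ler_norml.
  have h1 : e^-1 * (f z - f y) <= 1 by apply: h; near: z; exact: near_b.
  have h2 : - e^-1 * (f z - f y) <= 1 by apply: h; near: z; exact: near_b.
  rewrite ler_pdivrMl// mulr1 in h1.
  rewrite mulNr -mulrN ler_pdivrMl// mulr1 in h2.
  by apply/andP; split; lra.
have : \forall z \near (x : weak_topology V), f z < f x + 1.
  apply: (@continuous_weak f cf x [set r | r < f x + 1]).
  by apply: (@lt_nbhsl R); rewrite ltrDl.
apply: filterS => z fz Cz.
by have := fC (z - x); rewrite addrC subrK linearB => /(_ Cz) /=; lra.
Unshelve. all: by end_near.
Qed.

End WeakTopology.

(** The sets [A i] form a base of a filter; any of its cluster points belongs
to every [A i]. *)
Lemma precompact_directed_bigcap (T : topologicalType) (I : Type) (D : set I)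
    (A : I -> set T) (S : set T) (i0 : I) :
  precompact S -> D i0 -> A i0 `<=` S ->
  (forall i j, D i -> D j -> exists2 k, D k & A k `<=` A i `&` A j) ->
  (forall i, D i -> A i !=set0 /\ closed (A i)) ->
  \bigcap_(i in D) A i !=set0.
Proof.
rewrite precompactE => cS Di0 A0S dir hA.
have FF : ProperFilter (filter_from D A).
  apply: filter_from_proper; last by move=> i /hA[].
  by apply: filter_from_filter => //; exists i0.
have [|p [_ clp]] := cS (filter_from D A) FF.
  by exists i0 => //; exact: subset_trans (@subset_closure _ S).
exists p => i Di; have [_ clAi] := hA i Di.
rewrite (closure_id (A i)).1//; move: clp; rewrite clusterE; apply.
by exists i.
Qed.

Lemma closed_le_continuous (R : realType) (T : topologicalType)
    (phi : T -> \bar R) (a : T -> R) :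
  lower_semicontinuous phi -> continuous (a : T -> R) ->
  closed [set v | (phi v <= (a v)%:E)%E].
Proof.
move=> lphi ca; rewrite -[X in closed X]setCK; apply: open_closedC.
rewrite openE => v /= /negP; rewrite -ltNge => av.
have [r ar rphi] : exists2 r : R, a v < r & (r%:E < phi v)%E.
  case: (phi v) av => [s| |]; rewrite ?lte_fin ?ltNye//.
    by move=> h; exists ((a v + s) / 2); rewrite ?lte_fin; lra.
  by move=> _; exists (a v + 1); rewrite ?ltry//; lra.
have [W nW hW] := lphi v r rphi.
have na : \forall w \near v, a w < r.
  by apply: (ca v [set s | s < r]); exact: (@lt_nbhsl R).
near=> w; apply/negP; rewrite -ltNge; apply: (@lt_trans _ _ r%:E).
  by rewrite lte_fin; near: w.
by apply: hW; near: w.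
Unshelve. all: by end_near.
Qed.

(** * Real inner products *)

Section InnerProduct.
Variables (R : realType) (H : normedModType R) (ip : {dot H for @idfun R}).
Hypothesis ipnorm : norm_from ip.

Lemma ipC u v : ip u v = ip v u.
Proof. by rewrite hermC expr0 mul1r. Qed.

Lemma ipDr u v w : ip u (v + w) = ip u v + ip u w.
Proof. exact: linearDr. Qed.

Lemma ipBr u v w : ip u (v - w) = ip u v - ip u w.
Proof. exact: linearBr. Qed.

Lemma ipZr a u v : ip u (a *: v) = a * ip u v.
Proof. exact: linearZr_LR. Qed.

Lemma ipDl u v w : ip (u + v) w = ip u w + ip v w.
Proof. by rewrite ipC ipDr ipC [ip w v]ipC. Qed.

Lemma ipBl u v w : ip (u - v) w = ip u w - ip v w.
Proof. by rewrite ipC ipBr ipC [ip w v]ipC. Qed.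

Lemma ipZl a u v : ip (a *: u) v = a * ip u v.
Proof. by rewrite ipC ipZr ipC. Qed.

Lemma norm2D u v : `|u + v| ^+ 2 = `|u| ^+ 2 + `|v| ^+ 2 + 2 * ip u v.
Proof. by rewrite !ipnorm ipDl !ipDr [ip v u]ipC; ring. Qed.

Lemma norm2B u v : `|u - v| ^+ 2 = `|u| ^+ 2 + `|v| ^+ 2 - 2 * ip u v.
Proof. by rewrite !ipnorm ipBl !ipBr [ip v u]ipC; ring. Qed.

(** Expand [|u - K v|^2 >= 0]. *)
Lemma young_ip K u v : 0 < K ->
  2 * ip u v <= K^-1 * `|u| ^+ 2 + K * `|v| ^+ 2.
Proof.
move=> K0; have : 0 <= K^-1 * `|u - K *: v| ^+ 2.
  by rewrite mulr_ge0 ?sqr_ge0// invr_ge0 ltW.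
rewrite norm2B ipZr normrZ exprMn real_normK ?num_real//.
suff -> : K^-1 * (`|u| ^+ 2 + K ^+ 2 * `|v| ^+ 2 - 2 * (K * ip u v)) =
  K^-1 * `|u| ^+ 2 + K * `|v| ^+ 2 - 2 * ip u v by rewrite subr_ge0.
by field; rewrite gt_eqF.
Qed.

(** By polarization the inner product is a combination of norms. *)
Lemma continuous_ip g : continuous (ip g : H -> R^o).
Proof.
have -> : ip g = (fun x => 2^-1 * (`|g + x| ^+ 2 - `|g| ^+ 2 - `|x| ^+ 2)) :> (H -> R).
  by apply/funext => x; rewrite norm2D; field.
move=> x; apply: cvgM; first exact: cvg_cst.
have sqc (f : H -> R) : f @ x --> f x -> (fun y => f y ^+ 2) @ x --> f x ^+ 2.
  by move=> fx; rewrite expr2; under eq_fun do rewrite expr2; exact: cvgM.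
apply: cvgB; last by apply: sqc; apply: cvg_norm; exact: cvg_id.
apply: cvgB; last exact: cvg_cst.
by apply: sqc; apply: cvg_norm; apply: cvgD; [exact: cvg_cst|exact: cvg_id].
Qed.

End InnerProduct.

Section WeakContinuity.
Variables (R : realType) (V : tvsType R) (H : normedModType R).
Variables (ip : {dot H for @idfun R}) (j : {linear V -> H}).
Hypotheses (ipnorm : norm_from ip) (cj : weak_weak_continuous j).

Lemma continuous_ip_weak_weak g : continuous (fun v => ip g (j v) : R^o).
Proof.
have lin : linear (ip g : H -> R^o) by move=> a x y; rewrite ipDr ipZr.
pose lipg := GRing.isLinear.Build R H R^o *:%R (ip g) lin.
pose ipg : {linear H -> R^o} := HB.pack (ip g : H -> R^o) lipg.
move=> v.
have c1 := @continuous_weak _ H ipg (@continuous_ip _ _ _ ipnorm g) (j v).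
have c2 := @continuous_to_weak R V v.
exact: (cvg_comp _ _ (cvg_comp _ _ c2 (@cj v)) c1).
Qed.

End WeakContinuity.

(** * Subgradients and penalized minimization *)

Section GlobalSubgradient.
Variables (R : realType) (H : normedModType R) (ip : {dot H for @idfun R}).
Variables (V : lmodType R).

(** Along the segment from [uh] to [v] the difference quotient at [t <= 1] is
at most [phi v - phi uh] by convexity, so its lower limit is as well. *)
Lemma subgradient_global (j : V -> H) (phi : V -> \bar R) u f :
  no_ninfty phi -> convex_functional phi -> j_subgradient ip j phi (u, f) ->
  exists uh, [/\ j uh = u, phi uh \is a fin_num &
    forall v, (phi uh + (ip f (j (v - uh)))%:E <= phi v)%E].
Proof.
move=> nphi cphi [uh [/= uhD uhu lim]]; exists uh.
have fuh : phi uh \is a fin_num.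
  by rewrite fin_numElt ltNye uhD andbT; apply/eqP.
split=> // v; have := lim (v - uh); have := nphi v.
rewrite -(fineK fuh); set r := fine (phi uh).
case E : (phi v) => [s| |]//; last by rewrite leey.
move=> _ /le_trans le_lim; rewrite -EFinD lee_fin -lerBrDl -lee_fin.
apply: le_lim; rewrite limf_einfE; apply: ge_ereal_sup => _ [A nA <-].
have : \forall t \near (0 : R)^'+, [/\ A t, 0 < t & t <= 1].
  near=> t; split; near: t; [exact: nA|exact: nbhs_right_gt|exact: nbhs_right_le].
move=> /filter_ex [t [At t0 t1]].
have t01 : 0 <= t <= 1 by apply/andP; split; [exact: ltW|].
apply: (@le_trans _ _ ((phi (uh + t *: (v - uh))%R - r%:E) * (t^-1)%:E)%E).
  by apply: ereal_inf_lbound; exists t.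
rewrite lee_pdivrMr//.
have := cphi v uh t t01; rewrite E -(fineK fuh) -/r.
have -> : t *: v + (1 - t) *: uh = uh + t *: (v - uh).
  by rewrite scalerBl scale1r scalerBr addrC -addrA [- _ + _]addrC.
case: (phi _) => [q|/=|_]; last by rewrite addNye leNye.
  2: by rewrite -!EFinM -EFinD leye_eq.
by rewrite -!EFinM -!EFinD !lee_fin; lra.
Unshelve. all: by end_near. Qed.

End GlobalSubgradient.

Section Penalization.
Variables (R : realType) (V : tvsType R) (H : normedModType R).
Variables (ip : {dot H for @idfun R}) (j : {linear V -> H}).
Variables (phi : V -> \bar R).
Hypotheses (ipnorm : norm_from ip) (cj : weak_weak_continuous j).
Hypotheses (nphi : no_ninfty phi) (cphi : convex_functional phi).
Hypotheses (lphi : lower_semicontinuous phi) (ephi : j_elliptic j phi).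

Definition penalized (K : R) (u : H) (v : V) : \bar R :=
  (phi v + (K * `|j v - u| ^+ 2)%:E)%E.

Lemma penalized_leE K u v c :
  (penalized K u v <= c%:E)%E = (phi v <= (c - K * `|j v - u| ^+ 2)%:E)%E.
Proof.
rewrite /penalized; case: (phi v) => [r| |]; last by rewrite addNye !leNye.
  by rewrite -EFinD !lee_fin lerBrDr.
by rewrite addye// !leye_eq.
Qed.

(** [|j v - u|^2] is the supremum over [g] of the affine functions
[2 <g, j v - u> - |g|^2], so the sublevel is an intersection of sets
[{phi <= affine}], to each of which Mazur's theorem applies. *)
Lemma weakly_closed_sublevel_penalized K u c : 0 <= K ->
  closed (sublevel (penalized K u) c : set (weak_topology V)).
Proof.
move=> K0.
pose a (g : H) (v : V) : R := c - K * (2 * (ip g (j v) - ip g u) - `|g| ^+ 2).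
have -> : sublevel (penalized K u) c =
    \bigcap_(g in setT) [set v | (phi v <= (a g v)%:E)%E].
  apply/seteqP; split=> v /=; rewrite /sublevel/= penalized_leE.
    move=> h g _ /=; apply: (le_trans h); rewrite lee_fin /a lerD2l lerN2.
    rewrite ler_wpM2l// -ipBr; have := sqr_ge0 `|j v - u - g|.
    by rewrite (norm2B ipnorm) (ipC _ (_ - _)); lra.
  move=> /(_ (j v - u) I) /=; rewrite /a -ipBr -ipnorm.
  by congr (_ <= _%:E)%E; ring.
apply: closed_bigI => g _; apply: convex_weakly_closed.
  apply: closed_le_continuous => // v.
  have cg : (fun v => ip g (j v) : R^o) @ v --> ip g (j v).
    exact: continuous_ip_weak_weak.
  rewrite /a; apply: cvgB; first exact: cvg_cst.
  apply: cvgM; first exact: cvg_cst.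
  apply: cvgB; last exact: cvg_cst.
  apply: cvgM; first exact: cvg_cst.
  by apply: cvgB => //; exact: cvg_cst.
apply/convex_setP => x y t /= hx hy t01; apply: le_trans (cphi _ _ t01) _.
have /andP[t0 t1] := t01.
have -> : a g (t *: x + (1 - t) *: y) = t * a g x + (1 - t) * a g y.
  have jE : j (t *: x + (1 - t) *: y) = t *: j x + (1 - t) *: j y.
    by rewrite linearD !linearZ.
  by rewrite /a jE ipDr !ipZr; ring.
rewrite (EFinD (t * _)) (EFinM t) (EFinM (1 - t)); apply: leeD; apply: lee_wpmul2l => //.
by rewrite lee_fin subr_ge0.
Qed.

Section Minorant.
Variables (m0 : R) (x0 f0 : H).
Hypothesis minorant : forall v, ((m0 + ip f0 (j v - x0))%:E <= phi v)%E.

(** The penalty grows quadratically, the affine minorant only linearly. *)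
Lemma penalty_bound u c : exists B : R, forall K v, 2^-1 <= K ->
  (penalized K u v <= c%:E)%E -> K * `|j v - u| ^+ 2 <= B.
Proof.
exists (2 * (c - m0 - ip f0 (u - x0)) + 2 * `|f0| ^+ 2) => K v K2.
rewrite penalized_leE => /(le_trans (minorant v)); rewrite lee_fin.
have K0 : 0 < K by lra.
have := @young_ip _ _ _ ipnorm K f0 (u - j v) K0.
rewrite (distrC u) !ipBr.
have : K^-1 * `|f0| ^+ 2 <= 2 * `|f0| ^+ 2.
  by rewrite ler_wpM2r ?sqr_ge0// -[2]invrK lef_pV2 ?posrE// invr_gt0.
lra.
Qed.

(** The bound on the penalty places one of the sublevels inside a sublevel of
[phi_omega j phi omega], where weak compactness applies. Both the weight [k]
and the level [c] may vary with the index. *)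
Lemma penalized_bigcap (I : Type) (D : set I) (k c : I -> R) (u : H) (i0 : I) :
  D i0 -> (forall i, D i -> 2^-1 <= k i) ->
  (forall i, D i -> exists v, (penalized (k i) u v <= (c i)%:E)%E) ->
  (forall i i', D i -> D i' -> exists2 i2, D i2 &
     sublevel (penalized (k i2) u) (c i2) `<=`
     sublevel (penalized (k i) u) (c i) `&` sublevel (penalized (k i') u) (c i')) ->
  exists v, forall i, D i -> (penalized (k i) u v <= (c i)%:E)%E.
Proof.
move=> Di0 hk hne hdir; have [omega [omega0 _ coer]] := ephi.
have [B hB] := penalty_bound u (c i0).
pose c' := c i0 + omega * (2 * B + `|u| ^+ 2).
have [|i Di|v hv] := @precompact_directed_bigcap (weak_topology V) I D
  (fun i => sublevel (penalized (k i) u) (c i)) _ i0 (coer c') Di0 _ hdir.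
- move=> v hv; have := hB _ v (hk _ Di0) hv; move: hv; rewrite /sublevel/= penalized_leE.
  have k0 := hk _ Di0.
  have := sqr_ge0 `|j v - u|; set d := `|j v - u| ^+ 2 => d0.
  move=> hphi kB; rewrite /phi_omega.
  have jv : `|j v| ^+ 2 <= 2 * d + 2 * `|u| ^+ 2.
    have -> : `|j v| = `|(j v - u) + u| by rewrite subrK.
    have := sqr_ge0 `|(j v - u) - u|.
    by rewrite (norm2B ipnorm (_ - _)) (norm2D ipnorm (_ - _)) -/d; lra.
  have dB : d <= 2 * B by nra.
  have kd : 0 <= k i0 * d by nra.
  have h : omega / 2 * `|j v| ^+ 2 <= omega * (2 * B + `|u| ^+ 2) by nra.
  apply: le_trans (leeD hphi (_ : _ <= (omega * (2 * B + `|u| ^+ 2))%:E)%E) _.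
    by rewrite lee_fin.
  by rewrite -EFinD lee_fin /c'; lra.
- split; first by have [v hv] := hne i Di; exists v.
  by apply: weakly_closed_sublevel_penalized; have := hk i Di; lra.
- by exists v => i Di; exact: hv.
Qed.

(** A minimizer is a common point of all nonempty sublevels; boundedness from
below is a consequence of the existence of such a point. *)
Lemma exists_minimizer K u : 2^-1 <= K -> proper_functional phi ->
  exists2 uh, phi uh \is a fin_num & forall v, (penalized K u uh <= penalized K u v)%E.
Proof.
move=> K2 [w0 w0D].
pose D := [set c : R | exists v, (penalized K u v <= c%:E)%E].
have nonfin v : (phi v < +oo)%E -> exists2 c, D c & penalized K u v = c%:E.
  move=> vD; have := @nphi v; move: vD; rewrite /D/=.
  case E : (phi v) => [r| |]// _ _; exists (r + K * `|j v - u| ^+ 2).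
    by exists v; rewrite /penalized E.
  by rewrite /penalized E.
have [c0 Dc0 c0E] := nonfin _ w0D.
have [||a b Da Db|uh huh] := @penalized_bigcap R D (fun=> K) id u c0 Dc0.
- by [].
- by move=> c [v hv]; exists v.
- exists (Num.min a b); first by case: leP.
  by move=> v; rewrite /sublevel/= => h; split; apply: le_trans h _; rewrite lee_fin ge_min lexx ?orbT.
exists uh.
  have := huh _ Dc0; rewrite penalized_leE => /le_lt_trans/(_ (ltry _)) uhD.
  by rewrite fin_numElt uhD ltNye andbT; apply/eqP.
move=> v; case: (ltP (phi v) +oo%E) => [/nonfin[c Dc ->]|]; first exact: huh.
by rewrite leye_eq /penalized => /eqP ->; rewrite addye// leey.
Qed.

End Minorant.

(** Comparing [uh] with [uh + t w] and dividing by [t] leaves the linear term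
[<2K (u - j uh), j w>] of the penalty, up to [K t |j w|^2]. *)
Lemma minimizer_subgradient K u uh : 0 <= K -> phi uh \is a fin_num ->
  (forall v, (penalized K u uh <= penalized K u v)%E) ->
  j_subgradient ip j phi (j uh, (2 * K) *: (u - j uh)).
Proof.
move=> K0 fuh hmin; exists uh; split=> //=.
  by rewrite /effective_domain/= ltey_eq fuh.
move=> w; apply/lee_addgt0Pr => e e0.
rewrite limf_einfE.
pose c := K * `|j w| ^+ 2; have c0 : 0 <= c by rewrite mulr_ge0 ?sqr_ge0.
(* For t < e / (c + 1) the quadratic remainder t c is at most e. *)
have d0 : 0 < e / (c + 1) by rewrite divr_gt0//; lra.
rewrite -leeBlDr//; apply: le_trans; last first.
  apply: ereal_sup_ubound; exists `]0, e / (c + 1)[%classic => //.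
  near=> t; rewrite /= in_itv/=; apply/andP; split.
    by near: t; exact: nbhs_right_gt.
  by near: t; exact: nbhs_right_lt.
apply: le_ereal_inf_tmp => _ [t /= + <-]; rewrite in_itv/= => /andP[t0 te].
rewrite lee_pdivlMr//; have := hmin (uh + t *: w); rewrite /penalized.
rewrite -(fineK fuh) linearD linearZ/=.
case: (phi (uh + t *: w)) => [q| |]; last by rewrite addNye leeNy_eq.
  2: by move=> _; rewrite addye// leey.
rewrite -!EFinD -EFinM !lee_fin.
rewrite [j uh + _ - u]addrAC (norm2D ipnorm (j uh - u)) ipZr normrZ exprMn real_normK ?num_real//.
rewrite ipZl !ipBl.
rewrite ltr_pdivlMr in te; last lra.
have : t * t * c <= t * e by rewrite -mulrA ler_pM2l//; nra.
by rewrite /c; lra.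
Unshelve. all: by end_near. Qed.

End Penalization.

(** * Chains of subgradients *)

Section Chains.
Variables (R : realType) (H : normedModType R) (ip : {dot H for @idfun R}).
Hypothesis ipnorm : norm_from ip.
Variable A : set (H * H).
Hypothesis surjective : forall w, exists xf, A xf /\ xf.1 + xf.2 = w.

(** [A] is contained in the subgradient of [p], as far as test points in the
domain of [A] can tell. *)
Definition potential (p : H -> R) :=
  forall x f y g, A (x, f) -> A (y, g) -> p x + ip f (y - x) <= p y.

(** The pairs [z i] in [A] are chosen with sums equally spaced between [u + f]
and [v + g]. The inequality of [p] at [z i.+1] bounds the increment of [p] by
[<h_i, dx> + <dh, dx>], and the [N] errors satisfy
[<dh, dx> <= |dx + dh|^2 / 2 = |w|^2 / (2 N^2)]. *)
Lemma potential_chain (p : H -> R) u f v g (e : R) : potential p ->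
  A (u, f) -> A (v, g) -> 0 < e ->
  exists (n : nat) (x h : nat -> H),
    [/\ x 0%N = u /\ h 0%N = f, x n = v /\ h n = g, forall i, A (x i, h i)
      & p v - p u - e <= \sum_(0 <= i < n) ip (h i) (x i.+1 - x i)].
Proof.
move=> pp Auf Avg e0.
have [J /all_and2[AJ sumJ]] := choice surjective.
pose w := (v + g) - (u + f).
pose N := (Num.truncn (`|w| ^+ 2 / (2 * e))).+1.
have N0 : (0 : R) < N%:R by rewrite ltr0n.
have Nbig : `|w| ^+ 2 / (2 * N%:R) <= e.
  rewrite ler_pdivrMr; last by rewrite mulr_gt0.
  have := truncnS_gt (`|w| ^+ 2 / (2 * e)); rewrite -/N.
  by rewrite ltr_pdivrMr ?mulr_gt0//; lra.
pose z (i : nat) := if i == 0%N then (u, f) else if i == N then (v, g)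
  else J (u + f + (i%:R / N%:R) *: w).
have Az i : A (z i) by rewrite /z; case: eqP => // _; case: eqP.
have sumz i : (z i).1 + (z i).2 = u + f + (i%:R / N%:R) *: w.
  rewrite /z; case: eqP => [->|_]; first by rewrite mul0r scale0r addr0.
  case: eqP => [->|_]; last by rewrite sumJ.
  by rewrite divff ?gt_eqF// scale1r /w [RHS]addrC subrK.
exists N, (fun i => (z i).1), (fun i => (z i).2); split=> //.
- by rewrite /z /= eqxx.
- by move=> i; rewrite -surjective_pairing.
have zN : (z N).1 = v by rewrite /z/= eqxx.
have -> : p v - p u = \sum_(0 <= i < N) (p (z i.+1).1 - p (z i).1).
  by rewrite telescope_sumr// zN.
have step i : p (z i.+1).1 - p (z i).1 <=
    ip (z i).2 ((z i.+1).1 - (z i).1) + `|w| ^+ 2 / (2 * N%:R) / N%:R.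
  have pi : p (z i.+1).1 + ip (z i.+1).2 ((z i).1 - (z i.+1).1) <= p (z i).1.
    by apply: pp (z i).2 _ _; rewrite -surjective_pairing.
  set dx := (z i.+1).1 - (z i).1; set dh := (z i.+1).2 - (z i).2.
  have dw : dx + dh = N%:R^-1 *: w.
    have -> : dx + dh = ((z i.+1).1 + (z i.+1).2) - ((z i).1 + (z i).2).
      by rewrite opprD addrACA.
    rewrite !sumz opprD addrACA subrr add0r -scalerBl -mulrBl -natrB//.
    by rewrite subSnn mul1r.
  have : 2 * ip dh dx <= `|w| ^+ 2 / N%:R / N%:R.
    have : `|dx + dh| ^+ 2 = `|w| ^+ 2 / N%:R / N%:R.
      rewrite dw normrZ exprMn real_normK ?num_real//; field.
      by rewrite gt_eqF.
    rewrite (norm2D ipnorm) (ipC ip dx) => <-.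
    by rewrite lerDr addr_ge0 ?sqr_ge0.
  have -> : `|w| ^+ 2 / (2 * N%:R) / N%:R = 2^-1 * (`|w| ^+ 2 / N%:R / N%:R).
    by field; rewrite gt_eqF.
  rewrite /dx /dh ipBl !ipBr; rewrite ipBr in pi.
  lra.
rewrite lerBlDr; apply: le_trans (_ : _ <= \sum_(0 <= i < N)
    (ip (z i).2 ((z i.+1).1 - (z i).1) + `|w| ^+ 2 / (2 * N%:R) / N%:R)) _.
  by apply: ler_sum => i _; exact: step.
rewrite big_split/= lerD2l sumr_const_nat subn0 -[leLHS]mulr_natr.
by rewrite divfK ?gt_eqF.
Qed.

(** Along a chain, the increment of any other potential dominates the same
sum; exchanging the two potentials gives equality. *)
Lemma potential_unique (p q : H -> R) u f v g : potential p -> potential q ->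
  A (u, f) -> A (v, g) -> q v - q u = p v - p u.
Proof.
have le (p1 p2 : H -> R) u1 f1 v1 g1 : potential p1 -> potential p2 ->
    A (u1, f1) -> A (v1, g1) -> p1 v1 - p1 u1 <= p2 v1 - p2 u1.
  move=> pp1 pp2 A1 A2; apply/ler_addgt0Pr => e e0.
  have [n [x [h [[x0 h0] [xn hn] Axh hsum]]]] := potential_chain pp1 A1 A2 e0.
  rewrite -lerBlDr; apply: (le_trans hsum).
  have -> : p2 v1 - p2 u1 = \sum_(0 <= i < n) (p2 (x i.+1) - p2 (x i)).
    by rewrite telescope_sumr// xn x0.
  apply: ler_sum => i _.
  by rewrite lerBrDl; exact: pp2 (Axh i) (Axh i.+1).
by move=> pp pq Auf Avg; apply/eqP; rewrite eq_le !(le _ _ u f v g).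
Qed.

End Chains.

(** * The functionals phi0, phi1, phi2 and phi3 *)

Section Regularization.
Variables (R : realType) (V : tvsType R) (H : normedModType R).
Variables (ip : {dot H for @idfun R}) (j : {linear V -> H}).
Variables (phi : V -> \bar R) (u0 f0 : H).
Hypotheses (ipnorm : norm_from ip) (cj : weak_weak_continuous j).
Hypotheses (nphi : no_ninfty phi) (cphi : convex_functional phi).
Hypotheses (pphi : proper_functional phi).
Hypotheses (lphi : lower_semicontinuous phi) (ephi : j_elliptic j phi).
Hypothesis Auf0 : j_subgradient ip j phi (u0, f0).

Let A := j_subgradient ip j phi.
Let p u := fine (phi0 j phi u).

Lemma phi0_le v : (phi0 j phi (j v) <= phi v)%E.
Proof. by apply: ereal_inf_lbound; exists v. Qed.

(** Testing the subgradient inequality at the points over [u] shows that the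
infimum defining [phi0 u] is attained at the point realizing the
subgradient. *)
Lemma phi0_subgradient u f : A (u, f) -> phi0 j phi u = (p u)%:E /\
  forall v, ((p u + ip f (j v - u))%:E <= phi v)%E.
Proof.
move=> /(subgradient_global nphi cphi)[uh [juh fuh hmin]].
suff E : phi0 j phi u = phi uh.
  rewrite /p E fineK//; split=> // v.
  by have := hmin v; rewrite linearB juh EFinD fineK.
apply/eqP; rewrite eq_le -{1}juh phi0_le/=; apply: le_ereal_inf_tmp => _ [v jv <-].
by have := hmin v; rewrite linearB juh jv subrr linear0r adde0.
Qed.

Lemma phi0_minorant u f w : A (u, f) ->
  ((p u + ip f (w - u))%:E <= phi0 j phi w)%E.
Proof.
move=> /phi0_subgradient[_ h]; apply: le_ereal_inf_tmp => _ [v <- <-].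
exact: h.
Qed.

Lemma potential_phi0 : potential ip A p.
Proof.
move=> x f y g Axf Ayg; rewrite -lee_fin.
by rewrite -(phi0_subgradient Ayg).1; exact: phi0_minorant.
Qed.

(** The point [x = j uh] is the resolvent of [A] at [u]: it solves
[u - x = f / (2K)] with [(x, f)] in [A]. *)
Lemma resolvent K u : 2^-1 <= K -> exists uh, [/\ A (j uh, (2 * K) *: (u - j uh)),
  phi uh = (p (j uh))%:E & forall v, (penalized j phi K u uh <= penalized j phi K u v)%E].
Proof.
move=> K2; have K0 : 0 <= K by lra.
have [uh fuh hmin] := exists_minimizer ipnorm cj nphi cphi lphi ephi
  (phi0_subgradient Auf0).2 u K2 pphi.
have Auh := minimizer_subgradient ipnorm K0 fuh hmin.
exists uh; split=> //; rewrite -(phi0_subgradient Auh).1.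
apply/eqP; rewrite eq_le phi0_le andbT; apply: le_ereal_inf_tmp => _ [v jv <-].
by have := hmin v; rewrite /penalized jv leeD2rE.
Qed.

Lemma resolvent_surjective w : exists xf, A xf /\ xf.1 + xf.2 = w.
Proof.
have [uh [Auh _ _]] := resolvent w (lexx _).
exists (j uh, (2 * 2^-1) *: (w - j uh)); split=> //=.
by rewrite divff// scale1r addrC subrK.
Qed.

Lemma phi3_lbound u v f : A (v, f) ->
  ((p v + ip f (u - v))%:E <= phi3 ip j phi u)%E.
Proof.
move=> Avf; apply: ereal_sup_ubound; exists (v, f) => //=.
by rewrite (phi0_subgradient Avf).1 addrC EFinD.
Qed.

(** Each affine minorant in [phi3] is continuous, so it is nearly at least its
value at [u] on an open neighbourhood of [u]. *)
Lemma phi3_le_phi1 u : (phi3 ip j phi u <= phi1 j phi u)%E.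
Proof.
apply: ge_ereal_sup => _ [[v f] /= Avf <-].
rewrite (phi0_subgradient Avf).1 -EFinD; apply/lee_addgt0Pr => e e0.
rewrite -leeBlDr// -EFinB.
pose U := [set w | ip f u - e < ip f w].
have oU : open U.
  have := (continuousP _).1 (@continuous_ip _ _ _ ipnorm f) _ (@open_gt R (ip f u - e)).
  by [].
apply: le_trans; last first.
  apply: ereal_sup_ubound; exists U => //; split=> //.
  by rewrite /U/=; lra.
apply: le_ereal_inf_tmp => _ [w /= Uw <-].
apply: le_trans ((phi0_subgradient Avf).2 w); rewrite lee_fin !ipBr.
by move: Uw; rewrite /U/=; lra.
Qed.

Lemma phi1_le_phi0 u : (phi1 j phi u <= phi0 j phi u)%E.
Proof.
apply: ge_ereal_sup => _ [U [_ Uu] <-]; apply: le_ereal_inf_tmp => _ [v jv <-].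
by apply: ereal_inf_lbound; exists v => //=; rewrite jv.
Qed.

(** With [c = phi3 u], the resolvent for the weight [K] gives
[phi uh + 2K |j uh - u|^2 <= c]. A point [v] of penalized value at most [c]
for all [K] satisfies [j v = u] and [phi v <= c]. *)
Lemma phi0_le_phi3 u : (phi0 j phi u <= phi3 ip j phi u)%E.
Proof.
have := phi3_lbound u Auf0; case E : (phi3 ip j phi u) => [c| |]; last by rewrite leeNy_eq.
  2: by move=> _; rewrite leey.
move=> _.
have [||K K2|K K' K2 K2'|v hv] := @penalized_bigcap R V H ip j phi ipnorm cj cphi lphi
  ephi _ _ _ (phi0_subgradient Auf0).2 R [set K | 2^-1 <= K] id (fun=> c) u 2^-1.
- by rewrite /=.
- by [].
- have [uh [Auh phiuh _]] := resolvent u K2; exists uh.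
  rewrite penalized_leE phiuh lee_fin.
  have := phi3_lbound u Auh; rewrite E lee_fin ipZl -ipnorm (distrC u).
  have := sqr_ge0 `|j uh - u|; have : 0 <= K by move: K2; rewrite /=; lra.
  by move=> *; nra.
- exists (Num.max K K'); first by rewrite /= le_max (_ : 2^-1 <= K).
  move=> w; rewrite /sublevel/= !penalized_leE => h.
  by split; apply: (le_trans h); rewrite lee_fin lerD2l lerN2 ler_wpM2r ?sqr_ge0//
    le_max lexx ?orbT.
have jv : j v = u.
  apply/eqP; rewrite -subr_eq0 -normr_eq0 -sqrf_eq0 eq_le sqr_ge0 andbT leNgt.
  apply/negP => d0; set d := `|j v - u| ^+ 2 in d0 hv.
  have h K : 2^-1 <= K -> (phi v <= (c - K * d)%:E)%E by move=> /hv; rewrite penalized_leE.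
  have := @nphi v; move: h; case: (phi v) => [r| |] h // _.
    (* This weight makes the penalty exceed c - r. *)
    have K2 : 2^-1 <= 2^-1 + (`|c - r| + 1) / d.
      by rewrite lerDl divr_ge0 ?(ltW d0)// addr_ge0.
    have := h _ K2; rewrite lee_fin mulrDl divfK ?gt_eqF//.
    by have := ler_norm (c - r); lra.
  by have := h _ (lexx _); rewrite leye_eq.
rewrite -{1}jv; apply: le_trans (phi0_le v) _.
have := hv 2^-1 (lexx _); rewrite penalized_leE jv subrr normr0.
by rewrite expr0n/= mulr0 subr0.
Qed.

(** All steps but the last telescope to at most [phi0 (u_ n) - phi0 u0]; the
last one is an affine minorant in [phi3]. *)
Lemma phi2_le_phi3 u : (phi2 ip j phi u0 f0 u <= phi3 ip j phi u)%E.
Proof.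
apply: ge_ereal_sup => _ [n [x [h [[x0 h0] Axh xn ->]]]].
have Ai i : (i <= n)%N -> A (x i, h i).
  by case: i => [_|i hi]; [rewrite x0 h0|exact: Axh].
rewrite (phi0_subgradient Auf0).1 -EFinD.
apply: le_trans (phi3_lbound u (Ai n (leqnn _))); rewrite lee_fin.
rewrite big_nat_recr//= xn addrAC addrC [leRHS]addrC lerD2l.
rewrite -lerBrDr.
have -> : p (x n) - p u0 = \sum_(0 <= i < n) (p (x i.+1) - p (x i)).
  by rewrite telescope_sumr// x0.
rewrite big_nat [leRHS]big_nat.
apply: ler_sum => i /= hi; rewrite lerBrDl.
by apply: potential_phi0 (Ai _ (ltnW hi)) (Ai _ hi).
Qed.

(** A chain from [(u0, f0)] to [(v, g)], followed by the step from [v] to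
[u]. *)
Lemma phi3_le_phi2 u : (phi3 ip j phi u <= phi2 ip j phi u0 f0 u)%E.
Proof.
apply: ge_ereal_sup => _ [[v g] /= Avg <-].
rewrite (phi0_subgradient Avg).1 -EFinD; apply/lee_addgt0Pr => e e0.
have [n [x [h [[x0 h0] [xn hn] Axh hsum]]]] :=
  potential_chain ipnorm resolvent_surjective potential_phi0 Auf0 Avg e0.
rewrite -leeBlDr//; apply: le_trans; last first.
  apply: ereal_sup_ubound.
  exists n, (fun i => if (i <= n)%N then x i else u), h; split=> //.
  - by move=> i /andP[_ ->]; exact: Axh.
  - by rewrite ltnn.
rewrite (phi0_subgradient Auf0).1 -!EFinD lee_fin.
rewrite big_nat_recr//= leqnn ltnn hn xn.
rewrite (eq_big_nat _ _ (F2 := fun i => ip (h i) (x i.+1 - x i))); last first.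
  by move=> i /andP[_ hi]; rewrite hi (ltnW hi).
by move: hsum; rewrite -/(p v) -/(p u0); lra.
Qed.

End Regularization.

(** * Reconstruction of phi0 and uniqueness of the potential *)

Theorem theorem2p9 (R : realType) (V : tvsType R)
    (H : completeNormedModType R) (ip : {dot H for @idfun R})
    (j : {linear V -> H}) (phi : V -> \bar R) (phiH : H -> \bar R)
    (u0 f0 : H) :
  norm_from ip ->
  weak_weak_continuous j ->
  no_ninfty phi -> convex_functional phi -> proper_functional phi -> lower_semicontinuous phi ->
  j_elliptic j phi ->
  no_ninfty phiH -> convex_functional phiH -> proper_functional phiH -> lower_semicontinuous phiH ->
  j_subgradient ip j phi `<=` subgradient ip phiH ->
  j_subgradient ip j phi (u0, f0) ->
  [/\ exists c : R, forall u, phiH u = (phi0 j phi u + c%:E)%E,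
      phi0 j phi = phi1 j phi,
      phi1 j phi = phi2 ip j phi u0 f0,
      phi2 ip j phi u0 f0 = phi3 ip j phi
    & effective_domain phiH = j @` effective_domain phi].
Proof.
move=> ipnorm cj nphi cphi pphi lphi ephi npsi cpsi _ lpsi sub Auf0.
pose A := j_subgradient ip j phi.
pose p u := fine (phi0 j phi u).
have p0E u f : A (u, f) -> phi0 j phi u = (p u)%:E.
  by move=> /(phi0_subgradient nphi cphi)[].
have le31 u := phi3_le_phi1 j ipnorm nphi cphi u.
have le10 u := phi1_le_phi0 j phi u.
have le03 u := phi0_le_phi3 ipnorm cj nphi cphi pphi lphi ephi Auf0 u.
have E03 : phi0 j phi = phi3 ip j phi.
  apply/funext => u; apply/eqP; rewrite eq_le le03/=.
  exact: le_trans (le31 u) (le10 u).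
have E01 : phi0 j phi = phi1 j phi.
  by apply/funext => u; apply/eqP; rewrite eq_le le10 E03 le31.
have E23 : phi2 ip j phi u0 f0 = phi3 ip j phi.
  apply/funext => u; apply/eqP; rewrite eq_le.
  rewrite (phi2_le_phi3 nphi cphi Auf0).
  exact: phi3_le_phi2 ipnorm cj nphi cphi pphi lphi ephi Auf0 u.
have psi_ge v f w : A (v, f) -> phiH v \is a fin_num /\
    (phiH v + (ip f (w - v))%:E <= phiH w)%E.
  move=> /sub /(subgradient_global npsi cpsi)[vh [/= <- fv h]].
  by split=> //; exact: h.
pose q u := fine (phiH u).
have potq : potential ip A q.
  move=> x f y g Axf Ayg.
  have [fy _] := psi_ge _ _ x Ayg; have [fx] := psi_ge _ _ y Axf.
  by rewrite -(fineK fx) -(fineK fy) -EFinD lee_fin.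
pose c := q u0 - p u0.
have psiA v f : A (v, f) -> phiH v = (p v + c)%:E.
  move=> Avf; have [fv _] := psi_ge _ _ v Avf; rewrite -(fineK fv) -/(q v).
  have := potential_unique ipnorm
    (resolvent_surjective ipnorm cj nphi cphi pphi lphi ephi Auf0)
    (potential_phi0 nphi cphi) potq Auf0 Avf.
  by rewrite /c -/(p v) -/(p u0) => h; congr _%:E; lra.
have psiE u : phiH u = (phi0 j phi u + c%:E)%E.
  apply/eqP; rewrite eq_le; apply/andP; split; last first.
    rewrite E03 -leeBrDr//; apply: ge_ereal_sup => _ [[v f] /= Avf <-].
    have [_] := psi_ge _ _ u Avf; rewrite EFinN leeBrDr// (psiA _ _ Avf) (p0E _ _ Avf).
    by congr (_ <= _)%E; rewrite -!EFinD; congr _%:E; ring.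
  rewrite -leeBlDr//; apply: le_ereal_inf_tmp => _ [w jw <-]; rewrite leeBlDr//.
  have := nphi w; case phiw : (phi w) => [s| |]// _; last first.
    by rewrite addye// leey.
  rewrite -EFinD leNgt; apply/negP => /lpsi[W nW hW].
  (* With K > B / e^2 the resolvent lies in the ball of radius e around u, on
     which phiH exceeds s + c by lower semicontinuity. *)
  have [B hB] := penalty_bound ipnorm (phi0_subgradient nphi cphi Auf0).2 u s.
  have [e /= e0 eW] := (nbhs_ballP _ _).1 nW.
  have B0 : 0 <= Num.max B 0 by rewrite le_max lexx orbT.
  pose K := 1 + Num.max B 0 / e ^+ 2.
  have K2 : 2^-1 <= K.
    have : 0 <= Num.max B 0 / e ^+ 2 by rewrite divr_ge0 ?sqr_ge0.
    by rewrite /K; lra.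
  have [uh [Auh phiuh hmin]] :=
    resolvent ipnorm cj nphi cphi pphi lphi ephi Auf0 u K2.
  have : (penalized j phi K u uh <= s%:E)%E.
    apply: le_trans (hmin w) _.
    by rewrite /penalized phiw jw subrr normr0 expr0n/= mulr0 adde0.
  move=> /[dup] /(hB _ _ K2) KdB; rewrite penalized_leE phiuh lee_fin => ps.
  have : ((s + c)%:E < phiH (j uh))%E.
    apply/hW/eW; rewrite -ball_normE/= distrC ltNge; apply/negP => ed.
    have ed2 : e ^+ 2 <= `|j uh - u| ^+ 2 by rewrite ler_sqr ?nnegrE ?(ltW e0).
    have : K * e ^+ 2 <= B by apply: le_trans KdB; rewrite ler_wpM2l//; lra.
    rewrite /K mulrDl divfK ?sqrf_eq0 ?gt_eqF// mul1r.
    have : B <= Num.max B 0 by rewrite le_max lexx.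
    have : 0 < e ^+ 2 by rewrite exprn_gt0.
    lra.
  rewrite (psiA _ _ Auh) lte_fin.
  have : 0 <= K * `|j uh - u| ^+ 2 by rewrite mulr_ge0 ?sqr_ge0//; lra.
  by move: ps; rewrite -/(p (j uh)); lra.
split; first by exists c.
- exact: E01.
- by rewrite -E01 E03 E23.
- exact: E23.
apply/seteqP; split=> [u|_ [v vD <-]]; rewrite /effective_domain/= psiE.
  move=> h; have : (phi0 j phi u < +oo)%E.
    by move: h; rewrite !ltey; apply: contra => /eqP ->; rewrite addye.
  by move=> /ereal_inf_lt[_ [v jv <-] vD]; exists v.
by apply: lte_add_pinfty; [exact: le_lt_trans (phi0_le j phi v) vD|exact: ltry].
Qed.
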